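(* Let $\mathbb{P}$ be a proper poset and let $\theta$ be a sufficiently large regular cardinal with $\mathbb{P} \in H(\theta)$. Let $\mathbb{M}(\mathbb{P})$ be the poset whose conditions are pairs $p = (\mathcal{M}_p, w_p)$ such that (1) $\mathcal{M}_p$ is a finite $\in$-chain of countable elementary substructures of $H(\theta)$, (2) $w_p \in \mathbb{P}$, and (3) $w_p$ is an $(M,\mathbb{P})$-generic condition for every $M \in \mathcal{M}_p$; ordered by $q \le p$ iff $\mathcal{M}_p \subseteq \mathcal{M}_q$ and $w_q \le_{\mathbb{P}} w_p$. Then $\mathbb{M}(\mathbb{P})$ is proper.
   Context: An $\in$-chain is identified with the set of models in it. For a countable $M \prec H(\theta)$ with $\mathbb{P}\in M$, a condition $w$ is $(M,\mathbb{P})$-generic if for every dense $D \subseteq \mathbb{P}$ with $D \in M$, $D \cap M$ is predense below $w$. *)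

(* Defs.v *)
From HB Require Import structures.
From mathcomp Require Import all_boot.
From mathcomp Require Import boolp classical_sets functions cardinality.

Set Implicit Arguments.
Unset Strict Implicit.
Unset Printing Implicit Defensive.

Local Open Scope classical_set_scope.
Local Open Scope card_scope.

(** * The universe of sets

    Well-founded trees with small branching modulo bisimulation (Aczel).  With
    the axioms of [boolp] this is a model of second-order ZFC: it is
    extensional (for Leibniz equality) and well-founded, and a class is a set
    as soon as it is the range of a family indexed by a small type. *)

Inductive tree : Type := sup (J : Type) of (J -> tree).

Fixpoint bisim (t u : tree) : Prop :=
  match t, u with
  | sup J f, sup K g =>
      (forall i, exists j, bisim (f i) (g j)) /\
      (forall j, exists i, bisim (f i) (g j))
  end.

Definition tree_in (t u : tree) : Prop :=
  match u with sup J g => exists j, bisim t (g j) end.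

Definition zfset : Type := {A : set tree | exists t, A = bisim t}.

HB.instance Definition _ := gen_eqMixin zfset.
HB.instance Definition _ := gen_choiceMixin zfset.

Definition zclass (t : tree) : zfset := exist _ (bisim t : set tree) (ex_intro _ t erefl).
Definition zrepr (x : zfset) : tree := sval (cid (proj2_sig x)).

Definition zin (x y : zfset) : Prop := tree_in (zrepr x) (zrepr y).
Notation "x ∈ y" := (zin x y) (at level 70, no associativity).

Definition elts (x : zfset) : set zfset := [set y | y ∈ x].

Definition small (A : set zfset) : Prop := exists x, elts x = A.

Definition zset0 : zfset := zclass (@sup False (fun f => match f with end)).

HB.instance Definition _ := isPointed.Build zfset zset0.

(** The set with the same elements as [A]; a junk value if [A] is a proper
    class.  Every class to which it is applied below is shown to be small. *)
Definition zcomp (A : set zfset) : zfset := xget zset0 [set x | elts x = A].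

Section Universe.

Lemma bisim_refl t : bisim t t.
Proof. by elim: t => I f IH /=; split=> i; exists i. Qed.

Lemma bisim_sym t u : bisim t u -> bisim u t.
Proof.
elim: t u => I f IH [J g] /= [fg gf]; split.
- by move=> j; have [i /IH] := gf j; exists i.
- by move=> i; have [j /IH] := fg i; exists j.
Qed.

Lemma bisim_trans t u v : bisim t u -> bisim u v -> bisim t v.
Proof.
elim: t u v => I f IH [J g] [K h] /= [fg gf] [gh hg]; split.
- by move=> i; have [j fgij] := fg i; have [k /(IH _ _ _ fgij)] := gh j; exists k.
- by move=> k; have [j ghjk] := hg k; have [i fgij] := gf j; exists i; apply: IH fgij ghjk.
Qed.

Lemma bisim_eq t u : bisim t u -> bisim t = bisim u :> set tree.
Proof.
move=> tu; apply/seteqP; split=> v.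
- exact: bisim_trans (bisim_sym tu).
- exact: bisim_trans tu.
Qed.

Lemma zfset_eq (x y : zfset) : proj1_sig x = proj1_sig y -> x = y.
Proof.
case: x y => [A hA] [B hB] /= AB; subst B; congr exist; exact: Prop_irrelevance.
Qed.

Lemma zclass_eq t u : bisim t u -> zclass t = zclass u.
Proof. by move=> /bisim_eq tu; apply: zfset_eq. Qed.

Lemma zreprK x : zclass (zrepr x) = x.
Proof.
by rewrite /zrepr; case: cid => t /= xt; apply: zfset_eq; rewrite xt.
Qed.

Lemma zclassK t : bisim (zrepr (zclass t)) t.
Proof.
rewrite /zrepr; case: cid => u /= tu.
by rewrite -[bisim u]tu; apply: bisim_refl.
Qed.

Lemma tree_in_bisim t t' u u' : bisim t t' -> bisim u u' ->
  tree_in t u -> tree_in t' u'.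
Proof.
case: u u' => [J g] [K h] tt' /= [gh _] [j tj]; have [k gk] := gh j; exists k.
exact: bisim_trans (bisim_sym tt') (bisim_trans tj gk).
Qed.

Lemma zin_class t u : zclass t ∈ zclass u <-> tree_in t u.
Proof.
split; apply: tree_in_bisim; do ?exact: zclassK; exact: bisim_sym (zclassK _).
Qed.

Lemma zext x y : (forall z, z ∈ x <-> z ∈ y) -> x = y.
Proof.
rewrite -(zreprK x) -(zreprK y); move: (zrepr x) (zrepr y) => [I f] [J g] xy.
apply: zclass_eq => /=; split.
- move=> i; have /xy : zclass (f i) ∈ zclass (sup f).
    by apply/zin_class; exists i; apply: bisim_refl.
  by move=> /zin_class.
- move=> j; have /xy : zclass (g j) ∈ zclass (sup g).
    by apply/zin_class; exists j; apply: bisim_refl.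
  by move=> /zin_class [i /bisim_sym]; exists i.
Qed.

Lemma elts_inj : injective elts.
Proof. by move=> x y xy; apply: zext => z; rewrite -[z ∈ x]/(elts x z) xy. Qed.

Lemma zin_ind (Q : zfset -> Prop) :
  (forall x, (forall y, y ∈ x -> Q y) -> Q x) -> forall x, Q x.
Proof.
move=> IHQ x; rewrite -(zreprK x); elim: (zrepr x) => I f IH.
apply: IHQ => y; rewrite -(zreprK y) => /zin_class [i /zclass_eq ->]; exact: IH.
Qed.

Lemma zcompK A : small A -> elts (zcomp A) = A.
Proof. by move=> sA; apply: (@xgetPex _ zset0 [set x | elts x = A]). Qed.

Lemma zcomp_elts x : zcomp (elts x) = x.
Proof. by apply: elts_inj; rewrite zcompK //; exists x. Qed.

Lemma elts0 : elts zset0 = set0.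
Proof.
apply/seteqP; split=> // x; rewrite /elts /= -(zreprK x) => /zin_class.
by case=> -[].
Qed.

Lemma small_family (I : Type) (f : I -> zfset) : small [set x | exists i, f i = x].
Proof.
exists (zclass (sup (fun i => zrepr (f i)))); apply/seteqP; split=> x /=.
- rewrite /elts /= -{1}(zreprK x) => /zin_class [i /zclass_eq].
  by rewrite !zreprK => ->; exists i.
- move=> [i <-]; rewrite /elts /= -{1}(zreprK (f i)).
  by apply/zin_class; exists i; apply: bisim_refl.
Qed.

Lemma elts_family x :
  exists (I : Type) (f : I -> zfset), elts x = [set y | exists i, f i = y].
Proof.
rewrite -(zreprK x); case: (zrepr x) => I f; exists I, (fun i => zclass (f i)).
apply/seteqP; split=> y /=.
- rewrite /elts /= -{1}(zreprK y) => /zin_class [i /zclass_eq yi].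
  by exists i; rewrite -yi zreprK.
- by move=> [i <-]; apply/zin_class; exists i; apply: bisim_refl.
Qed.

Lemma small_pfamily (I : Type) (F : I -> zfset -> Prop) :
  (forall i x y, F i x -> F i y -> x = y) -> small [set x | exists i, F i x].
Proof.
move=> Ffun.
have [f fP] : {f : {i | exists x, F i x} -> zfset & forall i, F (sval i) (f i)}.
  by apply: (choice (P := fun i => F (sval i))) => -[i ?].
have [x xE] := small_family f; exists x; rewrite xE; apply/seteqP; split=> y /=.
- by move=> [i <-]; exists (sval i); apply: fP.
- move=> [i Fiy]; exists (exist _ i (ex_intro _ y Fiy)).
  by apply: (Ffun i) => //; apply: (fP (exist _ i _)).
Qed.

Lemma small_sub (A B : set zfset) : A `<=` B -> small B -> small A.
Proof.
move=> AB [x xB]; have [I [f fE]] := elts_family x.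
have [|y yE] := @small_pfamily I (fun i z => f i = z /\ A z).
  by move=> i a b [<- _] [<- _].
exists y; rewrite yE; apply/seteqP; split=> z /=; first by case=> i [].
move=> Az; have := AB _ Az; rewrite -xB fE => -[i fi]; by exists i.
Qed.

Lemma small_image2 (A B : set zfset) (f : zfset -> zfset -> zfset) :
  small A -> small B -> small [set f a b | a in A & b in B].
Proof.
move=> [x <-] [y <-]; have [I [g gE]] := elts_family x.
have [J [h hE]] := elts_family y.
have [z zE] := small_family (fun ij : I * J => f (g ij.1) (h ij.2)).
exists z; rewrite zE gE hE; apply/seteqP; split=> u /=.
- by case=> -[i j] /= <-; exists (g i); [exists i|exists (h j); [exists j|]].
- by move=> [_ [i <-] [_ [j <-] <-]]; exists (i, j).
Qed.

Lemma small_powerset x : small [set y | elts y `<=` elts x].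
Proof.
have [I [f fE]] := elts_family x.
have [|z zE] := @small_pfamily (I -> Prop)
    (fun S y => elts y = [set u | exists2 i, S i & f i = u]).
  by move=> S a b aE bE; apply: elts_inj; rewrite aE.
apply: (@small_sub _ (elts z)); last by exists z.
move=> y yx; rewrite zE; exists (fun i => f i ∈ y).
apply/seteqP; split=> u /=; last by move=> [i ? <-].
by move=> uy; have := yx _ uy; rewrite fE => -[i fiu]; exists i; rewrite ?fiu.
Qed.

Lemma small_set2 (a b : zfset) : small [set a; b].
Proof.
have [x xE] := small_family (fun c : bool => if c then a else b).
exists x; rewrite xE; apply/seteqP; split=> u /=.
- by case=> -[] <-; [left|right].
- by case=> ->; [exists true|exists false].
Qed.

Lemma small_bigcup (A : set zfset) :
  small A -> small [set y | exists2 x, A x & y ∈ x].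
Proof.
move=> [a <-]; have [I [f fE]] := elts_family a.
pose K i := projT1 (cid (elts_family (f i))).
have gP i : exists g : K i -> zfset, elts (f i) = [set y | exists k, g k = y].
  by rewrite /K; case: (cid _).
pose g i := projT1 (cid (gP i)).
have gE i : elts (f i) = [set y | exists k, g i k = y] by rewrite /g; case: (cid _).
have [z zE] := small_family (fun ik : {i : I & K i} => g (projT1 ik) (projT2 ik)).
exists z; rewrite zE; apply/seteqP; split=> y /=.
- move=> [[i k] /= <-]; exists (f i); first by rewrite fE; exists i.
  by rewrite -[_ ∈ _]/(elts (f i) (g i k)) gE; exists k.
- move=> [x]; rewrite fE => -[i <-]; rewrite -[_ ∈ _]/(elts (f i) y) gE => -[k <-].
  by exists (existT _ i k).
Qed.

End Universe.

(** * Ordered pairs (Kuratowski) *)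

Definition upair (a b : zfset) : zfset := zcomp [set a; b].
Definition opair (a b : zfset) : zfset := upair (upair a a) (upair a b).

Definition pfst (p : zfset) : zfset := xget zset0 [set a | exists b, p = opair a b].
Definition psnd (p : zfset) : zfset := xget zset0 [set b | exists a, p = opair a b].

Lemma elts_upair a b : elts (upair a b) = [set a; b].
Proof. exact/zcompK/small_set2. Qed.

Lemma upair_inj a b c d : upair a b = upair c d ->
  (a = c /\ b = d) \/ (a = d /\ b = c).
Proof.
move=> /(congr1 elts); rewrite !elts_upair => E.
have ha : [set c; d] a by rewrite -E; left.
have hb : [set c; d] b by rewrite -E; right.
have hc : [set a; b] c by rewrite E; left.
have hd : [set a; b] d by rewrite E; right.
by case: ha hb hc hd => /= ? [] /= ? [] /= ? [] /= ?; subst; auto.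
Qed.

Lemma opair_inj a b c d : opair a b = opair c d -> a = c /\ b = d.
Proof.
move=> /upair_inj [[/upair_inj E1 /upair_inj E2]|[/upair_inj E1 /upair_inj E2]];
  by case: E1 E2 => -[? ?] [] [? ?]; subst; auto.
Qed.

Lemma pfst_opair a b : pfst (opair a b) = a.
Proof.
rewrite /pfst; case: xgetP => [x -> [y /opair_inj[]]//|/(_ a)].
by case; exists b.
Qed.

Lemma psnd_opair a b : psnd (opair a b) = b.
Proof.
rewrite /psnd; case: xgetP => [x -> [y /opair_inj[]]//|/(_ b)].
by case; exists a.
Qed.

(** * Ordinals, cardinals and [H(θ)]

    Cardinalities are compared by means of arbitrary functions: by replacement,
    the restriction of any function to a set is a set. *)

Definition ztransitive (A : set zfset) : Prop :=
  forall x y, A x -> y ∈ x -> A y.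

Definition ordinal (a : zfset) : Prop :=
  ztransitive (elts a) /\ forall x, x ∈ a -> ztransitive (elts x).

Definition cardinal (k : zfset) : Prop :=
  ordinal k /\ forall a, a ∈ k -> ~ (elts k #<= elts a).

Definition cofinal_in (A : set zfset) (k : zfset) : Prop :=
  A `<=` elts k /\ forall a, a ∈ k -> exists2 b, A b & a = b \/ a ∈ b.

Definition regular_cardinal (k : zfset) : Prop :=
  [/\ cardinal k, infinite_set (elts k) &
      forall A, cofinal_in A k -> elts k #<= A].

Definition trcl (x : zfset) : set zfset :=
  [set z | forall A, ztransitive A -> elts x `<=` A -> A z].

Definition card_lt (A B : set zfset) : Prop := A #<= B /\ ~ (B #<= A).

Definition H (θ : zfset) : zfset := zcomp [set x | card_lt (trcl x) (elts θ)].

Lemma sub_trcl x : elts x `<=` trcl x.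
Proof. by move=> z zx A _; apply. Qed.

Lemma ztransitive_trcl x : ztransitive (trcl x).
Proof. by move=> y z yx zy A tA xA; apply: (tA y) => //; apply: yx. Qed.

Lemma small_H θ : small [set x | card_lt (trcl x) (elts θ)].
Proof.
have [I [e eE]] := elts_family θ.
(* [code RS x]: the structure (trcl x, ∈, x) is isomorphic to a structure RS on I *)
pose code (RS : (I -> I -> Prop) * (I -> Prop)) (x : zfset) :=
  exists h : zfset -> I, [/\ {in trcl x &, injective h},
    forall i j, RS.1 i j <->
      exists u v, [/\ trcl x u, trcl x v, u ∈ v, h u = i & h v = j] &
    forall i, RS.2 i <-> exists2 u, u ∈ x & h u = i].
have code_fun RS x y : code RS x -> code RS y -> x = y.
  move=> [h [hI hR hS]] [h' [hI' hR' hS']].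
  have hh' u u' : trcl x u -> trcl y u' -> h u = h' u' -> u = u'.
    elim/zin_ind: u u' => u IH u' xu yu' huu'; apply: zext => z; split=> zu.
      have xz := ztransitive_trcl xu zu.
      have /hR /hR' : exists a b, [/\ trcl x a, trcl x b, a ∈ b, h a = h z & h b = h u].
        by exists z, u.
      move=> [z' [v' [yz' yv' zv' hz']]]; rewrite huu' => /hI'.
      rewrite !inE => /(_ yv' yu') vu; rewrite (IH z zu z') // -?vu //.
    have yz := ztransitive_trcl yu' zu.
    have /hR' /hR :
        exists a b, [/\ trcl y a, trcl y b, a ∈ b, h' a = h' z & h' b = h' u'].
      by exists z, u'.
    move=> [z' [v' [xz' xv' zv' hz']]]; rewrite -huu' => /hI.
    rewrite !inE => /(_ xv' xu) vu; subst v'.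
    by rewrite -(IH z' zv' z).
  apply: zext => z; split=> zx.
    have /hS /hS' [z' z'y hz'] : exists2 u, u ∈ x & h u = h z by exists z.
    by rewrite (hh' z z') //; exact: sub_trcl.
  have /hS' /hS [z' z'x hz'] : exists2 u, u ∈ y & h' u = h' z by exists z.
  by rewrite -(hh' z' z) //; exact: sub_trcl.
apply: small_sub (small_pfamily code_fun) => x [xθ nθx].
have [i0 _] : exists i0 : I, True.
  apply: contrapT => noI; apply: nθx; rewrite eE.
  suff -> : [set y | exists i, e i = y] = set0 by exact: card_ge0.
  by apply/seteqP; split=> // y [i]; case: noI; exists i.
have /pcard_leP/unsquash f := xθ.
have fP u : exists i, trcl x u -> e i = f u.
  have [xu|] := pselect (trcl x u); last by exists i0.
  have : [set y | exists i, e i = y] (f u) by rewrite -eE; exact: (@funS _ _ _ _ f).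
  by move=> -[i ei]; exists i.
have [h hP] := choice fP.
have hI : {in trcl x &, injective h}.
  move=> u v; rewrite !inE => xu xv huv.
  apply: (@inj _ _ _ f); rewrite ?inE//.
  by transitivity (e (h u)); [rewrite hP|rewrite huv hP].
exists (fun i j => exists u v, [/\ trcl x u, trcl x v, u ∈ v, h u = i & h v = j],
        fun i => exists2 u, u ∈ x & h u = i).
by exists h.
Qed.

Lemma elts_H θ : elts (H θ) = [set x | card_lt (trcl x) (elts θ)].
Proof. exact/zcompK/small_H. Qed.

(** * First-order formulas in the language {∈, =}; variables are de Bruijn
    indices *)

Inductive formula : Type :=
| fin of nat & nat
| feq of nat & nat
| fnot of formula
| fand of formula & formula
| fall of formula.

Definition push (x : zfset) (e : nat -> zfset) : nat -> zfset :=
  fun n => if n is m.+1 then e m else x.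

Fixpoint sat (A : set zfset) (e : nat -> zfset) (phi : formula) : Prop :=
  match phi with
  | fin i j => e i ∈ e j
  | feq i j => e i = e j
  | fnot psi => ~ sat A e psi
  | fand psi chi => sat A e psi /\ sat A e chi
  | fall psi => forall x, A x -> sat A (push x e) psi
  end.

(* [(M, ∈)] is an elementary substructure of [(N, ∈)] *)
Definition elementary (M N : zfset) : Prop :=
  [/\ elts M !=set0, elts M `<=` elts N &
      forall (phi : formula) (e : nat -> zfset), (forall n, e n ∈ M) ->
        (sat (elts M) e phi <-> sat (elts N) e phi)].

Definition countable_elementary (M N : zfset) : Prop :=
  countable (elts M) /\ elementary M N.

(** * Posets and properness

    A poset is a set of the form [opair X L], where [X] is its set of conditions
    and [L] its order relation, as a set of ordered pairs. *)

Definition conditions (P : zfset) : zfset := pfst P.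
Definition ple (P p q : zfset) : Prop := opair p q ∈ psnd P.

Definition is_poset (P : zfset) : Prop :=
  [/\ P = opair (pfst P) (psnd P),
      forall z, z ∈ psnd P ->
        exists p q, [/\ p ∈ conditions P, q ∈ conditions P & z = opair p q],
      forall p, p ∈ conditions P -> ple P p p,
      forall p q, ple P p q -> ple P q p -> p = q &
      forall p q r, ple P p q -> ple P q r -> ple P p r].

Definition compatible (P p q : zfset) : Prop :=
  exists r, [/\ r ∈ conditions P, ple P r p & ple P r q].

Definition dense (P D : zfset) : Prop :=
  elts D `<=` elts (conditions P) /\
  forall p, p ∈ conditions P -> exists2 d, d ∈ D & ple P d p.

Definition predense_below (P : zfset) (A : set zfset) (w : zfset) : Prop :=
  forall r, r ∈ conditions P -> ple P r w -> exists2 d, A d & compatible P d r.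

(* The notion only makes sense for models [M] such that [P ∈ M]. *)
Definition generic (M P w : zfset) : Prop :=
  [/\ P ∈ M, w ∈ conditions P &
      forall D, D ∈ M -> dense P D -> predense_below P (elts D `&` elts M) w].

Definition for_large_regular (Q : zfset -> Prop) : Prop :=
  exists2 θ0, ordinal θ0 & forall θ, regular_cardinal θ -> θ0 ∈ θ -> Q θ.

Definition proper (P : zfset) : Prop :=
  is_poset P /\
  for_large_regular (fun θ => P ∈ H θ ->
    forall M, countable_elementary M (H θ) -> P ∈ M ->
    forall p, p ∈ conditions P -> p ∈ M ->
    exists q, [/\ q ∈ conditions P, ple P q p & generic M P q]).

(** * The poset [M(P)] *)

(* [c] is the set of terms of a finite sequence M_0 ∈ M_1 ∈ ... ∈ M_n *)
Definition finite_in_chain (c : zfset) : Prop :=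
  exists2 s : seq zfset, elts c = [set` s] & sorted (fun x y => `[< x ∈ y >]) s.

Definition MP_condition (θ P c w : zfset) : Prop :=
  [/\ finite_in_chain c /\ (forall M, M ∈ c -> countable_elementary M (H θ)),
      w ∈ conditions P &
      forall M, M ∈ c -> generic M P w].

Definition MP_conditions (θ P : zfset) : set zfset :=
  [set p | exists c w, p = opair c w /\ MP_condition θ P c w].

Definition MP_order (θ P : zfset) : set zfset :=
  [set z | exists q p,
    [/\ z = opair q p, MP_conditions θ P q, MP_conditions θ P p,
        elts (pfst p) `<=` elts (pfst q) & ple P (psnd q) (psnd p)]].

Definition MP (θ P : zfset) : zfset :=
  opair (zcomp (MP_conditions θ P)) (zcomp (MP_order θ P)).

Lemma small_MP_conditions θ P : small (MP_conditions θ P).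
Proof.
have [b bE] := small_powerset (H θ).
apply: small_sub (small_image2 opair (small_powerset b)
  (ex_intro _ (conditions P) erefl)) => p.
move=> [c [w [-> [[_ cM] wP _]]]]; exists c; last by exists w.
by move=> M /cM [_ [_ MH _]]; rewrite bE.
Qed.

Lemma small_MP_order θ P : small (MP_order θ P).
Proof.
apply: small_sub (small_image2 opair (small_MP_conditions θ P)
  (small_MP_conditions θ P)) => _ [q [p [-> cq cp _ _]]].
by exists q => //; exists p.
Qed.

Lemma conditions_MP θ P : elts (conditions (MP θ P)) = MP_conditions θ P.
Proof. by rewrite /conditions /MP pfst_opair; apply/zcompK/small_MP_conditions. Qed.

Lemma ple_MP θ P q p : ple (MP θ P) q p <->
  [/\ q ∈ conditions (MP θ P), p ∈ conditions (MP θ P),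
      elts (pfst p) `<=` elts (pfst q) & ple P (psnd q) (psnd p)].
Proof.
rewrite {1}/ple /MP psnd_opair -[_ ∈ zcomp _]/(elts _ _) zcompK; last first.
  exact: small_MP_order.
rewrite -[q ∈ _]/(elts _ _) -[p ∈ _]/(elts _ _) !conditions_MP; split.
- by move=> [_ [_ [/opair_inj[<- <-]]]].
- by move=> [? ? ? ?]; exists q, p.
Qed.

(* Main.v *)
(** Given a countable [N ≺ H(λ)] containing [M(P)], both [P] and [H(θ)] are
    definable from [M(P)] in [H(λ)]: the latter is the union of all models that
    occur in conditions, by Löwenheim–Skolem and the properness of [P].  So
    [M = N ∩ H(θ)] is a countable elementary substructure of [H(θ)], and a
    condition [(c, w) ∈ N] extends to [q = (c ∪ {M}, w')] with [w' ≤ w] an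
    [(M, P)]-generic condition.

    To see that [q] is [(N, M(P))]-generic, let [D ∈ N] be dense and let
    [(d, v) ≤ q] belong to [D].  The part [b] of the chain [d] below [M] is a
    finite subset of [N], so it is in [N], and so is the dense set of the [x]
    in [P] that either lie below some [a] with [(c', a) ∈ D] and [b ⊆ c'], or are
    incompatible with all such [a].  By genericity [v] is compatible with some
    [x ∈ M] in this set, which must be of the first kind since [v] is one of
    these [a].  By elementarity [(c', a)] can be taken in [N], and then
    [c' ∪ d] is an ∈-chain: [c'] comes first, then [M] and what follows it in [d].

    That ∈ is transitive on countable elementary substructures of [H(θ)] rests on
    the fact that they contain their countable elements as subsets. *)

From mathcomp Require Import all_boot.
From mathcomp Require Import boolp classical_sets functions cardinality.
Require Import Defs.

Set Implicit Arguments.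
Unset Strict Implicit.
Unset Printing Implicit Defensive.

Local Open Scope classical_set_scope.
Local Open Scope card_scope.

(** * Cardinalities *)

Lemma card_le_fun (T : Type) (U : pointedType) (A : set T) (B : set U) :
  A #<= B <-> exists2 f : T -> U, set_fun A B f & set_inj A f.
Proof.
rewrite -injfunPex; split; first by move/pcard_leP.
by move=> ?; apply/pcard_leP.
Qed.

Lemma card_le_rel (T : Type) (U : pointedType) (A : set T) (B : set U)
    (r : T -> U -> Prop) :
  (forall a, A a -> exists2 b, B b & r a b) ->
  (forall a a' b, A a -> A a' -> r a b -> r a' b -> a = a') -> A #<= B.
Proof.
move=> rT rI; have [a|f fP] := @choice _ _ (fun a b => A a -> B b /\ r a b).
  have [/rT[b Bb ab]|nA] := pselect (A a); first by exists b.
  by exists point.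
apply/card_le_fun; exists f => [a /fP[]//|a a'].
rewrite !inE => Aa Aa' ff; have [_ raf] := fP _ Aa; have [_ raf'] := fP _ Aa'.
by apply: (rI _ _ (f a)) => //; rewrite ff.
Qed.

(** Zorn's lemma for the partial injections from [A] to [B]: a maximal one that is neither total nor
    onto could be extended by a pair. *)
Lemma card_le_total (T U : pointedType) (A : set T) (B : set U) :
  A #<= B \/ B #<= A.
Proof.
pose Q : set (set (T * U)) := [set r |
  [/\ forall z, r z -> A z.1 /\ B z.2,
      forall a b b', r (a, b) -> r (a, b') -> b = b' &
      forall a a' b, r (a, b) -> r (a', b) -> a = a']].
have [F FQ Ftot|r [[rAB rfun rinj] rmax]] := @Zorn_bigcup _ Q.
  have FF z z' : (\bigcup_(X in F) X) z -> (\bigcup_(X in F) X) z' ->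
      exists2 X, F X & X z /\ X z'.
    move=> [X FX Xz] [Y FY Yz].
    by have [XY|YX] := Ftot _ _ FX FY; [exists Y => //|exists X => //]; split; auto.
  split.
  - by move=> z [X /FQ [XAB _ _] /XAB].
  - by move=> a b b' r r'; have [X /FQ[_ Xf _] []] := FF _ _ r r'; apply: Xf.
  - by move=> a a' b r r'; have [X /FQ[_ _ Xi] []] := FF _ _ r r'; apply: Xi.
have [rA|] := pselect (forall a, A a -> exists2 b, B b & r (a, b)).
  by left; apply: card_le_rel rA _ => a a' b _ _; apply: rinj.
move=> /existsNP[a /not_implyP[Aa na]].
have [rB|] := pselect (forall b, B b -> exists2 a, A a & r (a, b)).
  by right; apply: (card_le_rel rB) => b b' c _ _; apply: rfun.
move=> /existsNP[b /not_implyP[Bb nb]].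
have na' b' : ~ r (a, b').
  by move=> rab; apply: na; exists b' => //; have [] := rAB _ rab.
have nb' a' : ~ r (a', b).
  by move=> rab; apply: nb; exists a' => //; have [] := rAB _ rab.
exfalso; apply: (rmax (r `|` [set (a, b)])).
  split; first by move=> z; left.
  by move=> /(_ (a, b)) H; apply: (na' b); apply: H; right.
split.
- by move=> z [/rAB//|->].
- move=> x y y' [h|[? ?]] [h'|[? ?]]; subst => //.
  + exact: rfun h h'.
  + by case: (na' _ h).
  + by case: (na' _ h').
- move=> x x' y [h|[? ?]] [h'|[? ?]]; subst => //.
  + exact: rinj h h'.
  + by case: (nb' _ h).
  + by case: (nb' _ h').
Qed.

Lemma card_ltE (A B : set zfset) : card_lt A B <-> ~ (B #<= A).
Proof.
by split=> [[]//|nBA]; split=> //; have [|/nBA] := card_le_total A B.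
Qed.

Lemma card_lt_le (A B C : set zfset) : A #<= B -> card_lt B C -> card_lt A C.
Proof.
move=> AB /card_ltE nCB; apply/card_ltE => CA.
exact: nCB (card_le_trans CA AB).
Qed.

(** Double ∈-induction: if neither is a member of the other, the induction hypotheses put the
    members of each into the other, and extensionality applies. *)
Lemma ordinal_trichotomy k a b : ordinal k -> a ∈ k -> b ∈ k ->
  [\/ a ∈ b, a = b | b ∈ a].
Proof.
move=> [kT kE]; elim/zin_ind: a b => a IHa; elim/zin_ind => b IHb ak bk.
have [ab|] := pselect (exists2 y, y ∈ b & a = y \/ a ∈ y).
  case: ab => y yb [->|ay]; first by constructor 1.
  by constructor 1; apply: (kE _ bk y a).
have [ba|] := pselect (exists2 x, x ∈ a & b = x \/ b ∈ x).
  case: ba => x xa [->|bx] _; first by constructor 3.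
  by constructor 3; apply: (kE _ ak x b).
move=> nba nab; constructor 2; apply: zext => z; split=> zz.
- have zk : z ∈ k := kT _ _ ak zz.
  have [//|zb|bz] := IHa z zz b zk bk; case: nba; exists z; auto.
- have zk : z ∈ k := kT _ _ bk zz.
  have [az|az|//] := IHb z zz ak zk; case: nab; exists z; auto.
Qed.

Definition uncountable_regular (k : zfset) : Prop :=
  regular_cardinal k /\ ~ countable (elts k).

(** Suppose [g] injects [k] into the union. By regularity the preimage of each [B i] is bounded by
    some [f i] in [k], and since [k] is uncountable, the [f i] are bounded by some [a]. But [g a]
    lies in some [B i], which forces [a] below [f i]. *)
Lemma countable_union_lt (I : Type) (D : set I) (B : I -> set zfset) k :
  uncountable_regular k -> countable D ->
  (forall i, D i -> card_lt (B i) (elts k)) ->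
  card_lt (\bigcup_(i in D) B i) (elts k).
Proof.
move=> [[[kO kC] _ kreg] kunc] Dc Bk; apply/card_ltE => /card_le_fun[g gB ginj].
pose C i := [set a | a ∈ k /\ B i (g a)].
have bd i : exists a, D i -> a ∈ k /\ forall b, C i b -> ~ (a = b \/ a ∈ b).
  have [Di|] := pselect (D i); last by exists zset0.
  have : ~ cofinal_in (C i) k.
    move=> /kreg kCi; have /card_ltE := Bk i Di; apply.
    apply: (card_le_trans kCi); apply/card_le_fun; exists g => [a []//|a b].
    by rewrite !inE => -[ak _] [bk _]; apply: ginj; rewrite inE.
  move=> /not_andP[|/existsNP[a /not_implyP[ak na]]]; first by case=> a [].
  by exists a => _; split=> // b Cb ab; apply: na; exists b.
have [f fP] := choice bd.
have : ~ cofinal_in (f @` D) k.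
  move=> /kreg kf; apply: kunc; apply: card_le_trans kf _.
  exact: card_le_trans (card_image_le _ _) Dc.
move=> /not_andP[[_ [i /fP[]] ? _ <-//]|/existsNP[a /not_implyP[ak na]]].
have [i Di Ba] := gB a ak; have [fk /(_ a (conj ak Ba))] := fP i Di; apply.
have [||] := @ordinal_trichotomy k a (f i) kO ak fk; [|by auto..].
all: by move=> ?; case: na; exists (f i); auto; exists i.
Qed.

(** * [H(θ)] *)

Lemma trcl_sub x (A : set zfset) : ztransitive A -> elts x `<=` A -> trcl x `<=` A.
Proof. by move=> tA xA z; apply. Qed.

Lemma HE θ x : x ∈ H θ <-> card_lt (trcl x) (elts θ).
Proof. by rewrite -[x ∈ _]/(elts (H θ) x) elts_H. Qed.

Lemma H_sub_trcl θ x y : y ∈ H θ -> elts x `<=` trcl y -> x ∈ H θ.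
Proof.
move=> /HE yθ xy; apply/HE; apply: card_lt_le yθ; apply: subset_card_le.
exact: trcl_sub (@ztransitive_trcl y) xy.
Qed.

Lemma H_subset θ x y : y ∈ H θ -> elts x `<=` elts y -> x ∈ H θ.
Proof. by move=> yθ xy; apply: H_sub_trcl yθ (subset_trans xy (@sub_trcl y)). Qed.

Lemma H_transitive θ : ztransitive (elts (H θ)).
Proof.
move=> x y xθ yx; apply: H_sub_trcl xθ _ => z.
by apply: (@ztransitive_trcl x y z); apply: sub_trcl.
Qed.

(** The transitive closure of [x] is covered by the countably many sets [{y} ∪ trcl y] with [y ∈ x],
    each smaller than [θ]. *)
Lemma H_countable θ x : uncountable_regular θ ->
  countable (elts x) -> elts x `<=` elts (H θ) -> x ∈ H θ.
Proof.
move=> θr xc xH; apply/HE.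
have succ_lt y : y ∈ x -> card_lt ([set y] `|` trcl y) (elts θ).
  (* [bigcup2] makes the binary union a countable one; its sets beyond the second are empty. *)
  move=> yx; rewrite -bigcup2E; apply: countable_union_lt => // -[_|[_|n _]] /=.
  - by apply/card_ltE => /sub_countable /(_ (countable1 _)); case: θr.
  - by apply/HE; apply: xH.
  - by apply/card_ltE => /sub_countable /(_ (countable0 _)); case: θr.
apply: card_lt_le (countable_union_lt θr xc succ_lt); apply: subset_card_le.
apply: trcl_sub => [u v [y yx]|y yx]; last by exists y => //; left.
move=> [->|yu] vu; exists y => //; right; first exact: sub_trcl.
exact: ztransitive_trcl yu vu.
Qed.

Lemma H_mono θ l : cardinal l -> θ ∈ l -> elts (H θ) `<=` elts (H l).
Proof.
move=> [[lT _] lC] θl x /HE /card_ltE xθ; apply/HE/card_ltE => lx.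
apply: xθ; apply: card_le_trans lx; apply: subset_card_le => z; exact: lT.
Qed.

(** * Definability *)

(** Taking [Q] to be a predicate on assignments lets first-order properties be stated as ordinary
    propositions, with [e i] for the variable [i]. In the quantifier rules below, the bound variable
    takes index 0 and shifts the others. *)
Definition definable (N : zfset) (Q : (nat -> zfset) -> Prop) : Prop :=
  exists phi, forall e, (forall n, e n ∈ N) -> (sat (elts N) e phi <-> Q e).

Lemma eq_definable N (Q Q' : (nat -> zfset) -> Prop) :
  (forall e, (forall n, e n ∈ N) -> (Q e <-> Q' e)) -> definable N Q -> definable N Q'.
Proof. by move=> QQ' [phi phiP]; exists phi => e eN; rewrite phiP // QQ'. Qed.

Lemma push_in (N x : zfset) (e : nat -> zfset) :
  x ∈ N -> (forall n, e n ∈ N) -> forall n, push x e n ∈ N.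
Proof. by move=> xN eN []. Qed.

Section Definability.
Variable N : zfset.

Lemma definable_in i j : definable N (fun e => e i ∈ e j).
Proof. by exists (fin i j). Qed.

Lemma definable_eq i j : definable N (fun e => e i = e j).
Proof. by exists (feq i j). Qed.

Lemma definable_not Q : definable N Q -> definable N (fun e => ~ Q e).
Proof. by move=> [phi phiP]; exists (fnot phi) => e eN /=; rewrite phiP. Qed.

Lemma definable_and Q Q' : definable N Q -> definable N Q' ->
  definable N (fun e => Q e /\ Q' e).
Proof.
by move=> [phi phiP] [psi psiP]; exists (fand phi psi) => e eN /=; rewrite phiP // psiP.
Qed.

Lemma definable_or Q Q' : definable N Q -> definable N Q' ->
  definable N (fun e => Q e \/ Q' e).
Proof.
move=> dQ dQ'; have := definable_not (definable_and (definable_not dQ) (definable_not dQ')).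
apply: eq_definable => e _; split; last by tauto.
by move=> /not_andP[|] /contrapT; auto.
Qed.

Lemma definable_imp Q Q' : definable N Q -> definable N Q' ->
  definable N (fun e => Q e -> Q' e).
Proof.
move=> dQ dQ'; have := definable_not (definable_and dQ (definable_not dQ')).
apply: eq_definable => e _; split; last by tauto.
by move=> nQ Qe; apply: contrapT => nQ'; apply: nQ.
Qed.

Lemma definable_iff Q Q' : definable N Q -> definable N Q' ->
  definable N (fun e => Q e <-> Q' e).
Proof. by move=> dQ dQ'; apply: definable_and; apply: definable_imp. Qed.

Lemma definable_all (B : zfset -> (nat -> zfset) -> Prop) :
  definable N (fun e => B (e 0) (fun n => e n.+1)) ->
  definable N (fun e => forall x, x ∈ N -> B x e).
Proof.
move=> [phi phiP]; exists (fall phi) => e eN /=; split=> h x xN.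
  by have /(phiP _ (push_in xN eN)) := h x xN.
by apply/(phiP _ (push_in xN eN)); exact: h.
Qed.

Lemma definable_ex (B : zfset -> (nat -> zfset) -> Prop) :
  definable N (fun e => B (e 0) (fun n => e n.+1)) ->
  definable N (fun e => exists2 x, x ∈ N & B x e).
Proof.
move=> dB; have dB' : definable N (fun e => forall x, x ∈ N -> ~ B x e).
  exact/definable_all/definable_not.
apply: eq_definable (definable_not dB') => e _; split=> [|[x xN Bx] /(_ x xN)//].
by move=> /existsNP[x /not_implyP[xN /contrapT Bx]]; exists x.
Qed.

Hypothesis Ntr : ztransitive (elts N).

Lemma definable_all_in i (B : zfset -> (nat -> zfset) -> Prop) :
  definable N (fun e => B (e 0) (fun n => e n.+1)) ->
  definable N (fun e => forall x, x ∈ e i -> B x e).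
Proof.
move=> dB; have dB' : definable N (fun e => forall x, x ∈ N -> x ∈ e i -> B x e).
  exact/definable_all/definable_imp/dB/definable_in.
apply: eq_definable dB' => e eN; split=> h x; last by move=> _; apply: h.
by move=> xi; apply: h => //; apply: Ntr (eN i) xi.
Qed.

Lemma definable_ex_in i (B : zfset -> (nat -> zfset) -> Prop) :
  definable N (fun e => B (e 0) (fun n => e n.+1)) ->
  definable N (fun e => exists2 x, x ∈ e i & B x e).
Proof.
move=> dB.
have dB' : definable N (fun e => exists2 x, x ∈ N & x ∈ e i /\ B x e).
  exact/definable_ex/definable_and/dB/definable_in.
apply: eq_definable dB' => e eN; split=> [[x _ []]|[x xi Bx]]; exists x => //.
exact: Ntr (eN i) xi.
Qed.

Lemma definable_upair i j k : definable N (fun e => e i = upair (e j) (e k)).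
Proof.
have : definable N (fun e => (forall x, x ∈ e i -> x = e j \/ x = e k) /\
                             (e j ∈ e i /\ e k ∈ e i)).
  apply/definable_and/definable_and; try exact: definable_in.
  by apply/definable_all_in/definable_or; exact: definable_eq.
apply: eq_definable => e eN; split=> [[sub [ji ki]]|->].
  apply: elts_inj; rewrite elts_upair; apply/seteqP; split=> x; first exact: sub.
  by case=> ->.
rewrite -2![_ ∈ upair _ _]/(elts _ _) elts_upair; split; last by split; [left|right].
by move=> x; rewrite -[_ ∈ upair _ _]/(elts _ _) elts_upair.
Qed.

Lemma definable_opair i j k : definable N (fun e => e i = opair (e j) (e k)).
Proof.
have : definable N (fun e => exists2 u, u ∈ e i & exists2 v, v ∈ e i &
    (u = upair (e j) (e j) /\ v = upair (e j) (e k)) /\ e i = upair u v).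
  by do 2!apply: definable_ex_in => /=; do ?apply: definable_and; exact: definable_upair.
apply: eq_definable => e eN; split=> [[u _ [v _ [[-> ->] ->]]]//|ei].
by exists (upair (e j) (e j)); [|exists (upair (e j) (e k))] => //;
  rewrite ei /opair -[_ ∈ upair _ _]/(elts _ _) elts_upair; [left|right].
Qed.

Lemma definable_opair_in i j k : definable N (fun e => opair (e i) (e j) ∈ e k).
Proof.
have : definable N (fun e => exists2 z, z ∈ e k & z = opair (e i) (e j)).
  by apply: definable_ex_in => /=; exact: definable_opair.
by apply: eq_definable => e eN; split=> [[z zk <-]//|]; exists (opair (e i) (e j)).
Qed.

(** Relativises the quantifiers of [phi] to the set [e k]. The renaming [r] carries the induction
    through quantifiers, where [k] and the other variables shift. *)
Lemma definable_sat phi k (r : nat -> nat) :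
  definable N (fun e => sat (elts (e k)) (fun n => e (r n)) phi).
Proof.
elim: phi k r => [i j|i j|phi IH|phi IH psi IH'|phi IH] k r /=.
- exact: definable_in.
- exact: definable_eq.
- exact: definable_not.
- exact: definable_and.
apply: (@definable_all_in k
  (fun x e => sat (elts (e k)) (push x (fun n => e (r n))) phi)).
apply: eq_definable (IH k.+1 (fun n => if n is m.+1 then (r m).+1 else 0)) => e _.
suff -> : (fun n => e (if n is m.+1 then (r m).+1 else 0)) =
          push (e 0) (fun n => e (r n).+1) by [].
by apply/funext; case.
Qed.

End Definability.

Ltac definability :=
  cbv beta; simpl; solve [ first
  [ exact: definable_eq | exact: definable_in
  | by apply: definable_opair | by apply: definable_opair_in
  | apply: definable_all; definability
  | apply: definable_ex; definability
  | apply: definable_all_in; [done | definability]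
  | apply: definable_ex_in; [done | definability]
  | apply: definable_iff; definability
  | apply: definable_and; definability
  | apply: definable_or; definability
  | apply: definable_not; definability
  | apply: definable_imp; definability ] ].

(** * Elementary substructures *)

(** Elementarity is applied to the statement that there is no witness, whose failure in [N] passes
    to [M]. *)
Lemma elementary_witness M N e (B : zfset -> (nat -> zfset) -> Prop) :
  elementary M N -> definable N (fun e => B (e 0) (fun n => e n.+1)) ->
  (forall n, e n ∈ M) -> (exists2 x, x ∈ N & B x e) -> exists2 x, x ∈ M & B x e.
Proof.
move=> [_ MN Mel] [phi phiP] eM [x xN Bx].
have eN n : e n ∈ N := MN _ (eM n).
have : ~ sat (elts N) e (fall (fnot phi)).
  by move=> /(_ x xN) /=; apply; apply/(phiP _ (push_in xN eN)).
move=> /(Mel _ _ eM) /existsNP[y /not_implyP[yM /contrapT]].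
move=> /(Mel _ _ (push_in yM eM)) /(phiP _ (push_in (MN _ yM) eN)) By.
by exists y.
Qed.

Lemma elementary_unique M N e x (B : zfset -> (nat -> zfset) -> Prop) :
  elementary M N -> definable N (fun e => B (e 0) (fun n => e n.+1)) ->
  (forall n, e n ∈ M) -> x ∈ N -> B x e ->
  (forall y, y ∈ N -> B y e -> y = x) -> x ∈ M.
Proof.
move=> MN dB eM xN Bx Bu.
have [|y yM By] := elementary_witness MN dB eM; first by exists x.
by rewrite -(Bu y) //; case: MN => _ MN _; exact: MN yM.
Qed.

(* The definability hypothesis shifts [e] by two since the variable after [y] holds [x]. *)
Lemma elementary_comprehension M N e x (B : zfset -> (nat -> zfset) -> Prop) :
  ztransitive (elts N) -> elementary M N ->
  definable N (fun e => B (e 0) (fun n => e n.+2)) ->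
  (forall n, e n ∈ M) -> x ∈ N ->
  (forall y, y ∈ N -> (y ∈ x <-> B y e)) -> x ∈ M.
Proof.
move=> Ntr MN dB eM xN xB.
apply: (@elementary_unique M N e x
  (fun x e => forall y, y ∈ N -> (y ∈ x <-> B y e))) => //.
  apply: (@definable_all N (fun y e => y ∈ e 0 <-> B y (fun n => e n.+1))).
  by apply: definable_iff => //; exact: definable_in.
move=> y yN yB; apply: zext => z; split=> zy.
  by have zN := Ntr _ _ yN zy; apply/xB => //; apply/yB.
by have zN := Ntr _ _ xN zy; apply/yB => //; apply/xB.
Qed.

(** Induction on formulas: a counterexample in [N] to a universal formula yields one in [M], by the
    hypothesis for the negated body. *)
Lemma tarski_vaught M N : elts M !=set0 -> elts M `<=` elts N ->
  (forall phi e, (forall n, e n ∈ M) ->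
    (exists2 x, x ∈ N & sat (elts N) (push x e) phi) ->
    exists2 x, x ∈ M & sat (elts N) (push x e) phi) ->
  elementary M N.
Proof.
move=> M0 MN wit; split=> //; elim=> [i j|i j|phi IH|phi IH psi IH'|phi IH] e eM //=.
- by rewrite IH.
- by rewrite IH // IH'.
split=> h x xx; last first.
  by apply/(IH _ (push_in xx eM)); apply: h; apply: MN.
apply: contrapT => nphi.
have [|y yM] := wit (fnot phi) e eM; first by exists x.
by apply; apply/(IH _ (push_in yM eM)); apply: h.
Qed.

(* [a] generates [x] under the partial function [g]; unlike an enumeration by
   the natural numbers, this does not require ω to be definable. *)
Definition enumerates_by_successor (N x g a : zfset) : Prop :=
  a ∈ x /\
  (forall y, y ∈ N -> forall z, z ∈ N -> forall z', z' ∈ N ->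
     opair y z ∈ g -> opair y z' ∈ g -> z = z') /\
  forall u, u ∈ N -> a ∈ u ->
    (forall y, y ∈ u -> forall z, z ∈ x -> opair y z ∈ g -> z ∈ u) ->
    forall y, y ∈ x -> y ∈ u.

Lemma in_zcomp (A : set zfset) x : small A -> (x ∈ zcomp A <-> A x).
Proof. by move=> sA; rewrite -[x ∈ _]/(elts _ x) zcompK. Qed.

Lemma in_upair a b x : x ∈ upair a b <-> x = a \/ x = b.
Proof. by rewrite -[x ∈ _]/(elts _ x) elts_upair. Qed.

Lemma H_upair θ a b : uncountable_regular θ -> a ∈ H θ -> b ∈ H θ -> upair a b ∈ H θ.
Proof.
move=> θr aH bH; apply: H_countable => //; rewrite elts_upair.
  apply: finite_set_countable; exact: finite_set2.
by move=> x [->|->].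
Qed.

Lemma H_opair θ a b : uncountable_regular θ -> a ∈ H θ -> b ∈ H θ -> opair a b ∈ H θ.
Proof. by move=> θr aH bH; do !apply: H_upair. Qed.

(** [g] is the immediate successor relation, and [a] the least element, of the order on [x] pulled
    back along an injection [f] into the natural numbers. *)
Lemma exists_successor_enumeration θ x : uncountable_regular θ -> x ∈ H θ ->
  countable (elts x) -> elts x !=set0 ->
  exists2 g, g ∈ H θ & exists2 a, a ∈ H θ & enumerates_by_successor (H θ) x g a.
Proof.
move=> θr xH /countable_injP[f finj] [a0 a0x].
have xsub y : y ∈ x -> y ∈ H θ by apply: H_transitive.
have fI y z : y ∈ x -> z ∈ x -> f y = f z -> y = z.
  by move=> yx zx; apply: finj; rewrite inE.
pose G : set zfset := [set p | exists y z, [/\ p = opair y z, y ∈ x, z ∈ x, f y < f z &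
  forall w, w ∈ x -> f w <= f y \/ f z <= f w]].
have sG : small G.
  apply: small_sub (small_image2 opair (ex_intro _ x erefl) (ex_intro _ x erefl)) => p.
  by move=> [y [z [-> yx zx _ _]]]; exists y => //; exists z.
have GP p : p ∈ zcomp G <-> G p := in_zcomp p sG.
exists (zcomp G).
  apply: H_countable => //; rewrite zcompK //; last first.
    by move=> _ [y [z [-> /xsub yx /xsub zx _ _]]]; apply: H_opair.
  (* Since [f] is injective on [x], the code of [(f y, f z)] determines the pair, so [G] is
     countable. *)
  apply: (@card_le_rel _ nat _ _ (fun p n => exists y z,
      [/\ p = opair y z, y ∈ x, z ∈ x & n = choice.pickle (f y, f z)])).
    move=> _ [y [z [-> yx zx _ _]]].
    by exists (choice.pickle (f y, f z)) => //; exists y, z.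
  move=> p p' n _ _ [y [z [-> yx zx ->]]] [y' [z' [-> yx' zx' /(pcan_inj choice.pickleK)]]].
  by case=> /fI -> // /fI ->.
pose p n := `[< exists2 y, y ∈ x & f y = n >].
have [a ax amin] : exists2 a, a ∈ x & forall y, y ∈ x -> f a <= f y.
  have [|n /asboolP[a ax <-] nmin] := @ex_minnP p.
    by exists (f a0); apply/asboolP; exists a0.
  by exists a => // y yx; apply: nmin; apply/asboolP; exists y.
exists a; first exact: xsub.
split=> //; split.
  move=> y _ z _ z' _ /GP[y1 [z1 [/opair_inj[<- <-] _ zx yz zmin]]].
  move=> /GP[y2 [z2 [/opair_inj[<- <-] _ zx' yz' zmin']]].
  apply: fI => //; apply/eqP; rewrite eqn_leq.
  have [h|->] := zmin _ zx'; first by have := leq_ltn_trans h yz'; rewrite ltnn.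
  by have [h|->] := zmin' _ zx => //; have := leq_ltn_trans h yz; rewrite ltnn.
move=> u _ au uG y; have [n] := ubnP (f y); elim: n y => // n IH y fyn yx.
have [/fI <- //|ay] := eqVneq (f a) (f y).
have {}ay : f a < f y by rewrite ltn_neqAle ay amin.
(* The immediate predecessor of [y] is the [z] in [x] whose value [f z] is largest below [f y]. *)
pose q m := p m && (m < f y).
have [||m /andP[/asboolP[z zx <-] zy] zmax] := @ex_maxnP q (f y).
- by exists (f a); rewrite /q ay andbT; apply/asboolP; exists a.
- by move=> m /andP[_ /ltnW].
apply: (uG z) => //; first by apply: IH => //; apply: leq_trans zy _.
apply/GP; exists z, y; split=> // w wx; have [|wy] := leqP (f y) (f w); first by right.
by left; apply: zmax; rewrite /q wy andbT; apply/asboolP; exists w.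
Qed.

(** By elementarity some successor enumeration [g], [a] of [x] lies in [M]. Then [x ∩ M] contains
    [a] and is closed under [g], successors being definable, so it is all of [x]. *)
Lemma elementary_countable_subset θ M x : uncountable_regular θ ->
  elementary M (H θ) -> x ∈ M -> countable (elts x) -> elts x `<=` elts M.
Proof.
move=> θr MH xM xc y0 y0x; have Htr := @H_transitive θ.
have MsubH z : z ∈ M -> z ∈ H θ by case: MH => _ + _; apply.
have [|| |g gM [a' a'H gP']] := @elementary_witness M (H θ) (fun=> x)
    (fun g e => exists2 a, a ∈ H θ & enumerates_by_successor (H θ) (e 0) g a) MH.
- rewrite /enumerates_by_successor; definability.
- by [].
- by apply: exists_successor_enumeration => //; [exact: MsubH|exists y0].
have [|| |a aM [ax [gfun gall]]] := @elementary_witness M (H θ) (push x (fun=> g))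
    (fun a e => enumerates_by_successor (H θ) (e 0) (e 1) a) MH.
- rewrite /enumerates_by_successor; definability.
- exact: push_in.
- by exists a'.
(* The induction clause ranges over all [u] in [H θ], so [x ∩ M] only has to be an element of [H θ],
   not of [M]. *)
have su : small (elts x `&` elts M) by apply: small_sub (ex_intro _ x erefl) => ? [].
have uP z : z ∈ zcomp (elts x `&` elts M) <-> z ∈ x /\ z ∈ M := in_zcomp z su.
have /uP[] // : y0 ∈ zcomp (elts x `&` elts M).
apply: gall => //.
- by apply: H_subset (MsubH _ xM) _ => z /uP[].
- exact/uP.
move=> y /uP[yx yM] z zx yzg; apply/uP; split=> //.
have zH : z ∈ H θ by apply: Htr zx; apply: MsubH.
apply: (@elementary_unique M (H θ) (push y (fun=> g)) z
  (fun z e => opair (e 0) z ∈ e 1)) => //; first by definability.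
  exact: push_in.
by move=> z' z'H yz'; apply: (gfun y) => //; apply: MsubH.
Qed.

(** Satisfaction in [h] is definable over [N] from [h], so a witness in [h] can be taken in [M] as
    well, and the Tarski-Vaught test applies. *)
Lemma elementary_trace M N h : ztransitive (elts N) -> elementary M N ->
  h ∈ M -> elts h !=set0 -> elementary (zcomp (elts M `&` elts h)) h.
Proof.
move=> Ntr MN hM h0.
have sT : small (elts M `&` elts h) by apply: small_sub (ex_intro _ M erefl) => ? [].
have TP z : z ∈ zcomp (elts M `&` elts h) <-> z ∈ M /\ z ∈ h := in_zcomp z sT.
have hsubN z : z ∈ h -> z ∈ N by apply: Ntr; case: MN => _ + _; apply.
apply: tarski_vaught.
- have [|| |x xM /= xh] := @elementary_witness M N (fun=> h) (fun x e => x ∈ e 0) MN.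
  + definability.
  + by [].
  + by case: h0 => x xh; exists x => //; apply: hsubN.
  by exists x; apply/TP.
- by move=> z /TP[].
move=> phi e eT [x xh phix].
have [|| |y yM /= [yh phiy]] := @elementary_witness M N (push h e)
    (fun x e => x ∈ e 0 /\ sat (elts (e 0)) (push x (fun n => e n.+1)) phi) MN.
- apply: definable_and; first exact: definable_in.
  (* Index 1 holds [h], so the variables of [phi] become 0, 2, 3 and so on. *)
  apply: eq_definable (definable_sat Ntr phi 1 (fun n => if n is m.+1 then m.+2 else 0)).
  move=> e' _; suff -> : (fun n => e' (if n is m.+1 then m.+2 else 0)) =
          push (e' 0) (fun n => e' n.+2) by [].
  by apply/funext; case.
- by apply: push_in => // n; have /TP[] := eT n.
- by exists x => //; apply: hsubN.
by exists y => //; apply/TP.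
Qed.

(** * The downward Löwenheim–Skolem theorem *)

(** Makes formulas countable, so that a formula and a finite list of parameter indices fit into one
    natural number. *)
Fixpoint formula_code (phi : formula) : GenTree.tree nat :=
  match phi with
  | fin i j => GenTree.Node 0 [:: GenTree.Leaf i; GenTree.Leaf j]
  | feq i j => GenTree.Node 1 [:: GenTree.Leaf i; GenTree.Leaf j]
  | fnot psi => GenTree.Node 2 [:: formula_code psi]
  | fand psi chi => GenTree.Node 3 [:: formula_code psi; formula_code chi]
  | fall psi => GenTree.Node 4 [:: formula_code psi]
  end.

Fixpoint formula_decode (t : GenTree.tree nat) : formula :=
  match t with
  | GenTree.Node 0 [:: GenTree.Leaf i; GenTree.Leaf j] => fin i j
  | GenTree.Node 1 [:: GenTree.Leaf i; GenTree.Leaf j] => feq i j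
  | GenTree.Node 2 [:: u] => fnot (formula_decode u)
  | GenTree.Node 3 [:: u; v] => fand (formula_decode u) (formula_decode v)
  | GenTree.Node 4 [:: u] => fall (formula_decode u)
  | _ => feq 0 0
  end.

Lemma formula_codeK : cancel formula_code formula_decode.
Proof. by elim=> //= [phi ->|phi -> psi ->|phi ->]. Qed.

(** All free variables lie below this number, so finitely many parameters decide the truth of
    [phi]. *)
Fixpoint free_bound (phi : formula) : nat :=
  match phi with
  | fin i j | feq i j => (maxn i j).+1
  | fnot psi => free_bound psi
  | fand psi chi => maxn (free_bound psi) (free_bound chi)
  | fall psi => (free_bound psi).-1
  end.

Lemma sat_free_bound A phi e e' : (forall n, n < free_bound phi -> e n = e' n) ->
  sat A e phi <-> sat A e' phi.
Proof.
elim: phi e e' => [i j|i j|phi IH|phi IH psi IH'|phi IH] e e' ee' /=.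
- by rewrite !ee' //= ltnS ?leq_maxl ?leq_maxr.
- by rewrite !ee' //= ltnS ?leq_maxl ?leq_maxr.
- by rewrite (IH e e').
- rewrite (IH e e') ?(IH' e e') // => n nb; apply: ee' => /=.
    by rewrite leq_max nb orbT.
  by rewrite leq_max nb.
have ext x : sat A (push x e) phi <-> sat A (push x e') phi.
  apply: IH => -[|n] //= nb; apply: ee' => /=.
  by case: (free_bound phi) nb.
by split=> h x /h /ext.
Qed.

(** Closure of [s] under Skolem functions in ω stages: [E n] enumerates stage [n], and [M] is the
    union of the ranges. *)
Lemma lowenheim_skolem N (s : nat -> zfset) : (forall n, s n ∈ N) ->
  exists2 M, countable_elementary M N & forall n, s n ∈ M.
Proof.
move=> sN.
have [sk skP] : {sk : formula * (nat -> zfset) -> zfset | forall pe, sk pe ∈ N /\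
    ((exists2 x, x ∈ N & sat (elts N) (push x pe.2) pe.1) ->
     sat (elts N) (push (sk pe) pe.2) pe.1)}.
  have [pe|sk skP] := @choice _ _ (fun (pe : formula * (nat -> zfset)) y => y ∈ N /\
      ((exists2 x, x ∈ N & sat (elts N) (push x pe.2) pe.1) ->
       sat (elts N) (push y pe.2) pe.1)); last by exists sk.
  have [[x xN px]|no] := pselect (exists2 x, x ∈ N & sat (elts N) (push x pe.2) pe.1).
    by exists x.
  by exists (s 0).
pose code (phi : formula) (l : seq nat) := choice.pickle (formula_code phi, l).
(* The number [k] codes a formula and a list of indices into the previous stage [f]; [s 0] pads the
   list and is the value at numbers that code nothing. *)
pose next (f : nat -> zfset) (k : nat) : zfset :=
  if @choice.unpickle (GenTree.tree nat * seq nat)%type k is Some (t, l)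
  then sk (formula_decode t, nth (s 0) (map f l)) else s 0.
have nextE f phi l : next f (code phi l) = sk (phi, nth (s 0) (map f l)).
  by rewrite /next /code choice.pickleK formula_codeK.
pose E n := iter n next s.
have EN n k : E n k ∈ N.
  case: n => [|n] /=; first exact: sN.
  by rewrite /next; case: choice.unpickle => [[t l]|//]; exact: (skP (_, _)).1.
have Emono m n k : m <= n -> exists k', E n k' = E m k.
  move=> /subnKC <-; elim: (n - m) => [|d [k' <-]]; first by rewrite addn0; exists k.
  (* The stages increase: the formula equating variables 0 and 1 has its parameter as only
     witness. *)
  exists (code (feq 0 1) [:: k']); rewrite addnS /= nextE /=.
  have [_ /= ->] := skP (feq 0 1, nth (s 0) [:: E (m + d) k']) => //.
  by exists (E (m + d) k') => //; apply: EN.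
pose A : set zfset := [set x | exists nk : nat * nat, E nk.1 nk.2 = x].
have sA : small A := small_family _.
have AP x : x ∈ zcomp A <-> A x := in_zcomp x sA.
exists (zcomp A); last by move=> n; apply/AP; exists (0, n).
split.
  rewrite zcompK //; apply: (@card_le_rel _ nat _ _
    (fun x m => exists2 nk : nat * nat, E nk.1 nk.2 = x & m = choice.pickle nk)).
    by move=> x [nk nkx]; exists (choice.pickle nk) => //; exists nk.
  by move=> x x' m _ _ [nk <- ->] [nk' <- /(pcan_inj choice.pickleK) ->].
apply: tarski_vaught.
- by exists (s 0); apply/AP; exists (0, 0).
- by move=> _ /AP[nk <-]; apply: EN.
move=> phi e eA ex.
(* The finitely many relevant parameters all occur in one stage [lv]. *)
have [lv lvP] : exists lv, forall n, n < free_bound phi -> exists k, E lv k = e n.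
  elim: (free_bound phi) => [|b [lv IH]]; first by exists 0.
  have /AP[[m k] /= mk] := eA b; exists (maxn lv m) => n; rewrite ltnS leq_eqVlt.
  case/predU1P => [->|/IH[k' <-]]; first by rewrite -mk; exact: Emono (leq_maxr _ _).
  exact: Emono (leq_maxl _ _).
have [n|ix ixP] := @choice _ _ (fun n k => n < free_bound phi -> E lv k = e n).
  have [/lvP[k kP]|nb] := boolP (n < free_bound phi); first by exists k.
  by exists 0.
pose l := mkseq ix (free_bound phi).
have satE x : sat (elts N) (push x e) phi <->
              sat (elts N) (push x (nth (s 0) (map (E lv) l))) phi.
  apply: sat_free_bound => -[|n] //= /ltnW nb.
  by rewrite (nth_map 0) ?size_mkseq // nth_mkseq // ixP.
exists (E lv.+1 (code phi l)); first by apply/AP; exists (lv.+1, code phi l).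
apply/satE; rewrite /= nextE; case: (skP (phi, nth (s 0) (map (E lv) l))) => _; apply.
by case: ex => x xN /satE; exists x.
Qed.

(** * Pairs and finite sets in elementary substructures *)

Lemma transitive_opair (N a b : zfset) : ztransitive (elts N) ->
  opair a b ∈ N -> a ∈ N /\ b ∈ N.
Proof.
move=> Ntr abN; have uN : upair a b ∈ N by apply: Ntr abN _; apply/in_upair; right.
by split; apply: Ntr uN _; apply/in_upair; [left|right].
Qed.

Lemma elementary_sub M N x : elementary M N -> x ∈ M -> x ∈ N.
Proof. by case=> _ MN _; exact: MN. Qed.

Lemma elementary_opair_proj M N a b : ztransitive (elts N) -> elementary M N ->
  opair a b ∈ M -> a ∈ M /\ b ∈ M.
Proof.
move=> Ntr MN abM; have [aN bN] := transitive_opair Ntr (elementary_sub MN abM).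
split.
- apply: (@elementary_unique M N (fun=> opair a b) a
    (fun x e => exists2 y, y ∈ N & e 0 = opair x y)) => //; first by definability.
    by exists b.
  by move=> y _ [z _ /opair_inj[]].
- apply: (@elementary_unique M N (fun=> opair a b) b
    (fun x e => exists2 y, y ∈ N & e 0 = opair y x)) => //; first by definability.
    by exists a.
  by move=> y _ [z _ /opair_inj[]].
Qed.

Lemma elementary_opair M N a b : ztransitive (elts N) -> elementary M N ->
  opair a b ∈ N -> a ∈ M -> b ∈ M -> opair a b ∈ M.
Proof.
move=> Ntr MN abN aM bM.
apply: (@elementary_unique M N (push a (fun=> b)) _ (fun x e => x = opair (e 0) (e 1))) => //.
  definability.
exact: push_in.
Qed.

Definition zadjoin (x y : zfset) : zfset := zcomp (elts x `|` [set y]).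

Lemma small_setU (A B : set zfset) : small A -> small B -> small (A `|` B).
Proof.
move=> [a <-] [b <-].
apply: small_sub (small_bigcup (ex_intro _ (upair a b) erefl)) => z.
by case=> zz; [exists a|exists b] => //; apply/in_upair; [left|right].
Qed.

Lemma small_elts x : small (elts x).
Proof. by exists x. Qed.

Lemma small_set1 (x : zfset) : small [set x].
Proof. by exists (upair x x); rewrite elts_upair setUid. Qed.

Lemma in_zadjoin x y z : z ∈ zadjoin x y <-> z ∈ x \/ z = y.
Proof. exact/in_zcomp/small_setU/small_set1/small_elts. Qed.

(** Induction on [s]: the empty set is definable, adjoining an element is definable from parameters
    in [M], and finite subsets of [H θ] belong to [H θ]. *)
Lemma elementary_finite θ M (s : seq zfset) : uncountable_regular θ ->
  elementary M (H θ) -> (forall x, x \in s -> x ∈ M) ->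
  exists2 b, b ∈ M & elts b = [set` s].
Proof.
move=> θr MH; have Htr := @H_transitive θ.
have H_fin x (t : seq zfset) : elts x = [set` t] -> (forall y, y \in t -> y ∈ M) -> x ∈ H θ.
  move=> xt tM; apply: H_countable => //; rewrite xt.
    exact/finite_set_countable/finite_seq.
  by move=> y /tM; apply: elementary_sub.
elim: s => [|x s IH] sM.
  have e0 : elts zset0 = [set` [::]] by rewrite elts0; apply/seteqP; split.
  exists zset0 => //; have [m mM] : elts M !=set0 by case: MH.
  apply: (@elementary_comprehension M (H θ) (fun=> m) zset0 (fun y e => ~ y = y)) => //.
  - by definability.
  - exact: H_fin e0 _.
  - by move=> y _; split=> // y0; have : elts zset0 y by []; rewrite elts0.
have [b bM bE] : exists2 b, b ∈ M & elts b = [set` s].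
  by apply: IH => y ys; apply: sM; rewrite inE ys orbT.
have bxE : elts (zadjoin b x) = [set` x :: s].
  rewrite zcompK; last exact/small_setU/small_set1/small_elts.
  rewrite bE; apply/seteqP; split=> z /=; rewrite inE.
    by case=> [->|->]; rewrite ?orbT ?eqxx.
  by move=> /predU1P[->|]; [right|left].
exists (zadjoin b x) => //.
apply: (@elementary_comprehension M (H θ) (push b (fun=> x)) _
    (fun y e => y ∈ e 0 \/ y = e 1)) => //.
- by definability.
- by apply: push_in => // _; apply: sM; rewrite mem_head.
- exact: H_fin bxE sM.
- by move=> y _; exact: in_zadjoin.
Qed.

(** * Uncountable regular cardinals *)

Lemma zin_irrefl x : ~ x ∈ x.
Proof. by elim/zin_ind: x => x IH xx; apply: (IH x). Qed.

Fixpoint znat (n : nat) : zfset := if n is m.+1 then zadjoin (znat m) (znat m) else zset0.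

Lemma in_znat n x : x ∈ znat n <-> exists2 m, m < n & x = znat m.
Proof.
elim: n => [|n IH] /=.
  by split=> [x0|[]//]; have : elts zset0 x by []; rewrite elts0.
rewrite in_zadjoin IH; split.
  by case=> [[m mn ->]|->]; [exists m => //; apply: ltnW|exists n].
move=> [m]; rewrite ltnS leq_eqVlt => /predU1P[-> ->|mn ->]; first by right.
by left; exists m.
Qed.

Lemma znat_inj : injective znat.
Proof.
move=> m n mn; have [nm|nm|//] := ltngtP m n.
  by case: (@zin_irrefl (znat m)); rewrite {2}mn; apply/in_znat; exists m.
by case: (@zin_irrefl (znat n)); rewrite -{2}mn; apply/in_znat; exists n.
Qed.

Definition zomega : zfset := zcomp [set x | exists n, znat n = x].

Lemma in_zomega x : x ∈ zomega <-> exists n, znat n = x.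
Proof. exact/in_zcomp/small_family. Qed.

Lemma ordinal_zomega : ordinal zomega.
Proof.
split=> [x y|x].
  by move=> /in_zomega[n <-] /in_znat[m _ ->]; apply/in_zomega; exists m.
move=> /in_zomega[n <-] y z /in_znat[m mn ->] /in_znat[k km ->].
by apply/in_znat; exists k => //; apply: ltn_trans km mn.
Qed.

Lemma uncountable_regular_gt_omega k :
  regular_cardinal k -> zomega ∈ k -> uncountable_regular k.
Proof.
move=> kr ok; split=> // kc; case: kr => -[_ /(_ _ ok)] nk _ _; apply: nk.
apply: card_le_trans kc _; apply/card_le_fun; exists znat => [n _|m n _ _ /znat_inj//].
by apply/in_zomega; exists n.
Qed.

(** The union of the successors of [a] and [b] is an ordinal containing both. *)
Lemma ordinal_upper_bound a b : ordinal a -> ordinal b ->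
  exists2 c, ordinal c & a ∈ c /\ b ∈ c.
Proof.
have ordS x : ordinal x -> ordinal (zadjoin x x).
  move=> [xT xE]; split=> [y z|y] /in_zadjoin[yx|->] //.
  - by move=> zy; apply/in_zadjoin; left; apply: xT yx zy.
  - by move=> zx; apply/in_zadjoin; left.
  - exact: xE.
move=> /ordS [aT aE] /ordS [bT bE].
have cP z : z ∈ zcomp (elts (zadjoin a a) `|` elts (zadjoin b b)) <->
    z ∈ zadjoin a a \/ z ∈ zadjoin b b.
  by apply/in_zcomp/small_setU; exact: small_elts.
exists (zcomp (elts (zadjoin a a) `|` elts (zadjoin b b))).
  split=> [x y|x] /cP[xx|xx].
  - by move=> yx; apply/cP; left; apply: aT xx yx.
  - by move=> yx; apply/cP; right; apply: bT xx yx.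
  - exact: aE.
  - exact: bE.
by split; apply/cP; [left|right]; apply/in_zadjoin; right.
Qed.

Lemma uncountable_regular_above k l :
  uncountable_regular k -> regular_cardinal l -> k ∈ l -> uncountable_regular l.
Proof.
move=> [_ kunc] lr kl; split=> // lc; apply: kunc; apply: sub_countable lc.
by case: lr => -[[lT _] _] _ _; apply: subset_card_le => x; apply: lT.
Qed.

(** * The poset of side conditions *)

Lemma ple_conditions P p q : is_poset P -> ple P p q ->
  p ∈ conditions P /\ q ∈ conditions P.
Proof. by move=> [_ LP _ _ _] /LP[p' [q' [? ? /opair_inj[-> ->]]]]. Qed.

Lemma generic_le M P w w' : is_poset P -> generic M P w -> ple P w' w -> generic M P w'.
Proof.
move=> Ppo [PM _ wg] w'w; have [w'P _] := ple_conditions Ppo w'w.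
split=> // D DM Dd r rP rw'; apply: wg => //.
by case: Ppo => _ _ _ _ tr; apply: tr w'w.
Qed.

Lemma in_conditions_MP θ P p : p ∈ conditions (MP θ P) <-> MP_conditions θ P p.
Proof. by rewrite -[p ∈ _]/(elts _ p) conditions_MP. Qed.

Lemma opair_MP_condition θ P c w :
  opair c w ∈ conditions (MP θ P) <-> MP_condition θ P c w.
Proof.
rewrite in_conditions_MP; split; last by exists c, w.
by move=> [c' [w' [/opair_inj[-> ->]]]].
Qed.

Lemma MP_poset θ P : is_poset P -> is_poset (MP θ P).
Proof.
move=> Ppo; have [_ _ Prefl Panti Ptr] := Ppo; split.
- by rewrite {2}/MP pfst_opair psnd_opair.
- move=> z; rewrite /MP psnd_opair => /(in_zcomp z (small_MP_order θ P)).
  by move=> [q [p [-> cq cp _ _]]]; exists q, p; split=> //; apply/in_conditions_MP.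
- move=> p pM; apply/ple_MP; split=> //; move/in_conditions_MP: pM.
  by move=> [c [w [-> [_ wP _]]]]; rewrite psnd_opair; apply: Prefl.
- move=> p q /ple_MP[/in_conditions_MP[c [w [-> _]]] /in_conditions_MP[c' [w' [-> _]]]].
  rewrite !pfst_opair !psnd_opair => cc ww' /ple_MP[_ _].
  rewrite !pfst_opair !psnd_opair => cc' w'w; congr opair; last exact: Panti.
  by apply: elts_inj; apply/seteqP.
- move=> p q r /ple_MP[pM _ qp pq] /ple_MP[_ rM rq qr]; apply/ple_MP; split=> //.
    exact: subset_trans rq qp.
  exact: Ptr pq qr.
Qed.

(** Makes every condition of [P] occur as a second coordinate in [MP θ P], from which [P] is
    recovered later. *)
Lemma MP_condition0 θ P w : w ∈ conditions P -> opair zset0 w ∈ conditions (MP θ P).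
Proof.
move=> wP; have z0 M : ~ M ∈ zset0 by rewrite -[_ ∈ _]/(elts _ M) elts0.
apply/opair_MP_condition; split=> //; last by move=> M /z0.
split; last by move=> M /z0.
by exists [::] => //; rewrite elts0; apply/seteqP; split.
Qed.

(** * Finite ∈-chains of models *)

Lemma sorted_cat_cons (T : Type) (e : rel T) s1 x s2 :
  sorted e (s1 ++ x :: s2) = sorted e (rcons s1 x) && path e x s2.
Proof.
by rewrite -cat_rcons; case: s1 => [|y s1] //=; rewrite cat_path last_rcons.
Qed.

Lemma sorted_rcons_all (T : eqType) (e : rel T) s x :
  sorted e s -> (forall y, y \in s -> e y x) -> sorted e (rcons s x).
Proof.
case: s => [//|y s] /= ys sx; rewrite rcons_path ys /=.
by apply: sx; exact: mem_last.
Qed.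

Local Notation zin_rel := (fun x y : zfset => `[< x ∈ y >]).

(** Going down from [M]: a model [z] of the chain that is in [M] is countable, hence a subset of
    [M], so its predecessor [y ∈ z] is in [M] too. *)
Lemma chain_below θ M s : uncountable_regular θ -> elementary M (H θ) ->
  sorted zin_rel (rcons s M) -> (forall x, x \in s -> countable (elts x)) ->
  forall x, x \in s -> x ∈ M.
Proof.
move=> θr MH; elim: s => [//|y s IH] ys sc.
have sM x : x \in s -> x ∈ M.
  apply: IH; first exact: path_sorted ys.
  by move=> z zs; apply: sc; rewrite inE zs orbT.
move=> x; rewrite inE => /predU1P[->|/sM//].
case: s ys sc sM {IH} => [|z s] /= /andP[/asboolP yz _] sc sM //.
apply: (elementary_countable_subset θr MH (sM z (mem_head _ _)) _ yz).
by apply: sc; rewrite !inE eqxx orbT.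
Qed.

Lemma countable_elementary_in_H θ N : uncountable_regular θ ->
  countable_elementary N (H θ) -> N ∈ H θ.
Proof. by move=> θr [Nc [_ NH _]]; apply: H_countable. Qed.

(** * Recovering [P] and [H θ] inside [N] *)

Section Properness.
Variables (θ l P N : zfset).
Hypotheses (θr : uncountable_regular θ) (lr : uncountable_regular l) (θl : θ ∈ l).
Hypotheses (Ppo : is_poset P) (PH : P ∈ H θ).
Hypotheses (Nel : countable_elementary N (H l)) (MPN : MP θ P ∈ N).

Let Htr : ztransitive (elts (H l)) := @H_transitive l.
Let NH : elementary N (H l) := Nel.2.
Let P_E : P = opair (conditions P) (psnd P). Proof. by case: Ppo. Qed.

Lemma H_θ_l x : x ∈ H θ -> x ∈ H l.
Proof. by case: lr => -[lc _ _] _; exact: H_mono lc θl x. Qed.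

Lemma conditions_in_H : conditions P ∈ H θ.
Proof.
by case: (@transitive_opair (H θ) (conditions P) (psnd P) (@H_transitive θ)); rewrite -?P_E.
Qed.

(** The conditions and the order of [P] are the projections to second coordinates of those of
    [MP θ P]; conditions with empty chain show that nothing is missed. *)
Lemma poset_in_elementary : P ∈ N.
Proof.
have PHl := H_θ_l PH.
have [XHl LHl] : conditions P ∈ H l /\ psnd P ∈ H l.
  by apply: transitive_opair => //; rewrite -P_E.
have [CN ON] := elementary_opair_proj Htr NH MPN.
rewrite P_E; apply: (@elementary_opair N (H l)) => //; first by rewrite -P_E.
- apply: (@elementary_comprehension N (H l) (fun=> zcomp (MP_conditions θ P)) _
    (fun w e => exists2 p, p ∈ e 0 & exists2 c, c ∈ H l & p = opair c w)) => //.
    by definability.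
  move=> w wH; split=> [wP|[p /(in_zcomp p (small_MP_conditions θ P)) pC [c _ pE]]].
    have := MP_condition0 θ wP; rewrite /conditions /MP pfst_opair => wC.
    exists (opair zset0 w) => //; exists zset0 => //.
    have := Htr (elementary_sub NH CN) wC.
    by move=> /(transitive_opair Htr)[].
  by move: pC; rewrite pE => /in_conditions_MP/opair_MP_condition[].
apply: (@elementary_comprehension N (H l) (fun=> zcomp (MP_order θ P)) _
  (fun y e => exists2 z, z ∈ e 0 & exists2 q, q ∈ H l & exists2 p, p ∈ H l &
     z = opair q p /\ exists2 c, c ∈ H l & exists2 w, w ∈ H l & q = opair c w /\
     exists2 c', c' ∈ H l & exists2 w', w' ∈ H l & p = opair c' w' /\
     y = opair w w')) => //.
  by definability.
move=> y yH; split.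
  case: (Ppo) => _ LP _ _ _ yL; have [w [w' [wP w'P yE]]] := LP _ yL.
  have qp : ple (MP θ P) (opair zset0 w) (opair zset0 w').
    apply/ple_MP; rewrite !pfst_opair !psnd_opair; split=> //; try exact: MP_condition0.
    by rewrite /ple -yE.
  have qpO : opair (opair zset0 w) (opair zset0 w') ∈ zcomp (MP_order θ P).
    by move: qp; rewrite {1}/ple {1}/MP psnd_opair.
  have [qH pH] := transitive_opair Htr (Htr (elementary_sub NH ON) qpO).
  have [zH wH] := transitive_opair Htr qH; have [_ w'H] := transitive_opair Htr pH.
  exists (opair (opair zset0 w) (opair zset0 w')) => //.
  exists (opair zset0 w) => //; exists (opair zset0 w') => //; split=> //.
  exists zset0 => //; exists w => //; split=> //.
  by exists zset0 => //; exists w'.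
move=> [z /(in_zcomp z (small_MP_order θ P)) [q [p [-> _ _ _ qp]]]].
move=> [q' _ [p' _ [/opair_inj[? ?]]]]; subst q' p'.
move=> [c _ [w _ [qE [c' _ [w' _ [pE ->]]]]]].
by move: qp; rewrite qE pE !psnd_opair.
Qed.

Hypothesis Pgen : forall M, countable_elementary M (H θ) -> P ∈ M ->
  forall p, p ∈ conditions P -> p ∈ M ->
  exists q, [/\ q ∈ conditions P, ple P q p & generic M P q].

(** For [x] in [H θ], properness of [P] is applied below [w0] to a countable model containing [x],
    [P] and [w0]; this model alone forms the chain of a condition. *)
Lemma H_in_elementary w0 : w0 ∈ conditions P -> H θ ∈ N.
Proof.
move=> w0P; have [CN _] := elementary_opair_proj Htr NH MPN.
have CH := elementary_sub NH CN.
have w0H : w0 ∈ H θ := H_transitive conditions_in_H w0P.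
have cover x : x ∈ H θ -> exists c w m,
    [/\ opair c w ∈ zcomp (MP_conditions θ P), m ∈ c & x ∈ m].
  move=> xH.
  have [|m mel sm] := @lowenheim_skolem (H θ) (push x (push P (fun=> w0))).
    by do !apply: push_in => //.
  have [q [qP _ qg]] := Pgen mel (sm 1) w0P (sm 2).
  exists (upair m m), q, m; split; [|by apply/in_upair; left|exact: (sm 0)].
  apply/in_zcomp; first exact: small_MP_conditions.
  apply/in_conditions_MP/opair_MP_condition; split=> //; last first.
    by move=> m' /in_upair[] ->.
  split; last by move=> m' /in_upair[] ->.
  exists [:: m] => //; rewrite elts_upair setUid.
  by apply/seteqP; split=> z /=; rewrite inE => /eqP.
apply: (@elementary_comprehension N (H l) (fun=> zcomp (MP_conditions θ P)) _
  (fun x e => exists2 p, p ∈ e 0 & exists2 c, c ∈ H l & exists2 w, w ∈ H l &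
    p = opair c w /\ exists2 m, m ∈ c & x ∈ m)) => //.
- by definability.
(* [H θ] is an element of [H l] because its elements lie in the transitive closure of the set of
   conditions of [MP θ P]. *)
- apply: H_sub_trcl CH _ => x /cover[c [w [m [cwC mc xm]]]].
  have cT : trcl (zcomp (MP_conditions θ P)) c.
    apply: (@ztransitive_trcl _ (upair c w)); last by apply/in_upair; left.
    apply: (@ztransitive_trcl _ (opair c w)); last by apply/in_upair; right.
    exact: sub_trcl.
  exact: ztransitive_trcl (ztransitive_trcl cT mc) xm.
move=> x _; split=> [/cover[c [w [m [cwC mc xm]]]]|].
  have [cH wH] := transitive_opair Htr (Htr CH cwC).
  exists (opair c w) => //; exists c => //; exists w => //; split=> //.
  by exists m.
move=> [p /(in_zcomp p (small_MP_conditions θ P)) pC [c _ [w _ [pE [m mc xm]]]]].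
move: pC; rewrite pE => /in_conditions_MP/opair_MP_condition[[_ /(_ _ mc) [_ mH]] _ _].
exact: elementary_sub mH xm.
Qed.

(** * The model [N ∩ H(θ)] and generic conditions over [N] *)

Definition trace : zfset := zcomp (elts N `&` elts (H θ)).

Lemma in_trace x : x ∈ trace <-> x ∈ N /\ x ∈ H θ.
Proof. by apply/in_zcomp/(small_sub _ (small_elts N)) => ? []. Qed.

Lemma trace_countable_elementary : H θ ∈ N -> countable_elementary trace (H θ).
Proof.
move=> HθN; split; last by apply: elementary_trace NH HθN _ => //; exists P.
by apply: sub_countable Nel.1; apply: subset_card_le => x /in_trace[].
Qed.

Lemma finite_chain_in_elementary c : finite_in_chain c -> c ∈ N -> elts c `<=` elts N.
Proof.
move=> [s cs _] cN; apply: elementary_countable_subset lr NH cN _.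
by rewrite cs; exact/finite_set_countable/finite_seq.
Qed.

Lemma MP_generic c w : H θ ∈ N -> MP_condition θ P c w -> trace ∈ c ->
  generic N (MP θ P) (opair c w).
Proof.
move=> HθN cw tc; split=> //; first exact/opair_MP_condition.
move=> D DN [Dsub Ddense] r0 r0P r0cw.
(* It suffices to find a member of [D ∩ N] compatible with [d], which is below [r0] and hence below
   [(c, w)]. *)
have [d dD dr0] := Ddense r0 r0P.
have MPpo := MP_poset θ Ppo; have [_ _ _ _ MPtr] := MPpo.
have [_ _ Prefl _ Ptr] := Ppo.
have /ple_MP[dP _ sub_cd dw] := MPtr _ _ _ dr0 r0cw.
move/in_conditions_MP: (dP) => [cd [wd [dE cwd]]].
move: sub_cd dw; rewrite dE !pfst_opair !psnd_opair => sub_cd dw.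
have [[[s sE ssort] cel] wdP cgen] := cwd.
have sP x : x \in s <-> x ∈ cd by rewrite -[x ∈ cd]/(elts cd x) sE.
have ts : trace \in s by apply/sP/sub_cd.
have [tel tH] := trace_countable_elementary HθN.
case/path.splitPr: ts sE ssort sP => s1 s2 sE ssort sP.
move: ssort; rewrite sorted_cat_cons => /andP[s1sort s2sort].
have s1t x : x \in s1 -> x ∈ trace.
  apply: (chain_below θr tH s1sort) => {}x xs1.
  by case: (cel x) => //; apply/sP; rewrite mem_cat xs1.
have [b bN bE] : exists2 b, b ∈ N & elts b = [set` s1].
  by apply: elementary_finite lr NH _ => x /s1t /in_trace[].
have PN := poset_in_elementary.
have [XN LN] : conditions P ∈ N /\ psnd P ∈ N.
  by apply: elementary_opair_proj Htr NH _; rewrite -P_E.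
(* Restricting [c] to [H l] makes [A] definable over [H l]; the coordinates of pairs in [D] are
   there anyway. *)
pose A a := exists2 d, d ∈ D & exists2 c, c ∈ H l &
  d = opair c a /\ forall x, x ∈ b -> x ∈ c.
pose EE := [set v | v ∈ conditions P /\
  ((exists2 a, a ∈ H l & A a /\ ple P v a) \/
   ~ exists2 a, a ∈ H l & A a /\ exists2 z, z ∈ conditions P & ple P z v /\ ple P z a)].
have sEE : small EE by apply: small_sub (small_elts (conditions P)) => v [].
have EP v : v ∈ zcomp EE <-> EE v := in_zcomp v sEE.
have XHθ := conditions_in_H.
(* The genericity of [wd] concerns dense sets in [trace], so [EE] must be shown to lie in both [H θ]
   and [N]. *)
have EHθ : zcomp EE ∈ H θ by apply: H_subset XHθ _ => v /EP[].
have EN : zcomp EE ∈ N.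
  apply: (@elementary_comprehension N (H l)
    (push D (push b (push (conditions P) (fun=> psnd P)))) _
    (fun v e => v ∈ e 2 /\
      ((exists2 a, a ∈ H l & (exists2 d, d ∈ e 0 & exists2 c, c ∈ H l &
          d = opair c a /\ forall x, x ∈ e 1 -> x ∈ c) /\ opair v a ∈ e 3) \/
       ~ exists2 a, a ∈ H l & (exists2 d, d ∈ e 0 & exists2 c, c ∈ H l &
          d = opair c a /\ forall x, x ∈ e 1 -> x ∈ c) /\
          exists2 z, z ∈ e 2 & opair z v ∈ e 3 /\ opair z a ∈ e 3))) => //.
  - by definability.
  - by do !apply: push_in => //.
  - exact: H_θ_l.
have Xl v : v ∈ conditions P -> v ∈ H l.
  by apply: Htr; apply: H_θ_l.
have Edense : dense P (zcomp EE).
  split=> [v /EP[]//|v vP].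
  have [[a aH [Aa [z zP [zv za]]]]|no] := pselect (exists2 a, a ∈ H l & A a /\
      exists2 z, z ∈ conditions P & ple P z v /\ ple P z a).
    by exists z => //; apply/EP; split=> //; left; exists a.
  by exists v; [apply/EP; split=> //; right|exact: Prefl].
have dDopair : opair cd wd ∈ D by rewrite -dE.
have Awd : A wd.
  exists d => //; exists cd; last first.
    split=> // x; rewrite -[x ∈ b]/(elts b x) bE /= => xs1.
    by apply/sP; rewrite mem_cat xs1.
  have := Htr (elementary_sub NH DN) dDopair.
  by move=> /(transitive_opair Htr)[].
have [_ _ tgen] := cgen _ (sub_cd _ tc).
have Et : zcomp EE ∈ trace by apply/in_trace.
(* Genericity, applied to [wd] as an extension of itself, gives a common extension [z] of [wd] and
   some [v] in [EE ∩ trace]. *)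
have [v [/EP[vP vA] /in_trace[vN vHθ]] [z [zP zv zwd]]] :=
  tgen _ Et Edense wd wdP (Prefl _ wdP).
case: vA => [[a aH [Aa va]]|]; last first.
  by case; exists wd; [exact: Xl|split=> //; exists z].
have [|| |d' d'N /= [d'D [c' c'H [a' a'H [d'E [bc' va']]]]]] :=
    @elementary_witness N (H l) (push D (push b (push v (fun=> psnd P))))
    (fun d e => d ∈ e 0 /\ exists2 c, c ∈ H l & exists2 a, a ∈ H l &
      d = opair c a /\ ((forall x, x ∈ e 1 -> x ∈ c) /\ opair (e 2) a ∈ e 3)) NH.
- by definability.
- by do !apply: push_in => //.
- case: Aa => d' d'D [c' c'H [d'E bc']]; exists d'; last first.
    by split=> //; exists c' => //; exists a.
  exact: Htr (elementary_sub NH DN) d'D.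
exists d' => //.
have d'P := Dsub _ d'D.
have /opair_MP_condition[[c'chain c'el] a'P c'gen] : opair c' a' ∈ conditions (MP θ P).
  by rewrite -d'E.
have [c'N _] : c' ∈ N /\ a' ∈ N by apply: elementary_opair_proj Htr NH _; rewrite -d'E.
have c't x : x ∈ c' -> x ∈ trace.
  move=> xc'; apply/in_trace; split; first exact: finite_chain_in_elementary c'N _ xc'.
  exact: countable_elementary_in_H (c'el _ xc').
have [s' s'E s'sort] := c'chain.
have s'P x : x \in s' <-> x ∈ c' by rewrite -[x ∈ c']/(elts c' x) s'E.
(* The new chain omits [s1], whose models form [b] and so already belong to [c']. *)
have su : small [set` s' ++ trace :: s2].
  apply: small_sub (small_setU (small_elts c') (small_elts cd)) => x /=.
  rewrite mem_cat => /orP[/s'P|xs]; first by left.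
  by right; apply/sP; rewrite mem_cat xs orbT.
pose u := zcomp [set` s' ++ trace :: s2].
have uE : elts u = [set` s' ++ trace :: s2] := zcompK su.
have c'u x : x ∈ c' -> x ∈ u.
  by move=> /s'P xs; rewrite -[x ∈ u]/(elts u x) uE /= mem_cat xs.
have cdu x : x ∈ cd -> x ∈ u.
  move=> /sP; rewrite mem_cat => /orP[xs1|xs].
    by apply/c'u/bc'; rewrite -[x ∈ b]/(elts b x) bE.
  by rewrite -[x ∈ u]/(elts u x) uE /= mem_cat xs orbT.
have uP x : x ∈ u -> x ∈ c' \/ x ∈ cd.
  rewrite -[x ∈ u]/(elts u x) uE /= mem_cat => /orP[/s'P|xs]; first by left.
  by right; apply/sP; rewrite mem_cat xs orbT.
(* Being below both [a'] and [wd], [z] inherits genericity for the models of [c'] and of [cd]. *)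
have za' : ple P z a' := Ptr _ _ _ zv va'.
have uz : opair u z ∈ conditions (MP θ P).
  apply/opair_MP_condition; split=> //; last first.
    move=> m /uP[/c'gen mg|/cgen mg]; first exact: generic_le mg za'.
    exact: generic_le mg zwd.
  split; last by move=> m /uP[/c'el|/cel].
  exists (s' ++ trace :: s2) => //; rewrite sorted_cat_cons s2sort andbT.
  by apply: sorted_rcons_all => // x /s'P /c't ?; apply/asboolP.
have uzd' : ple (MP θ P) (opair u z) d'.
  by apply/ple_MP; rewrite d'E !pfst_opair !psnd_opair -d'E; split.
have uzd : ple (MP θ P) (opair u z) d.
  by apply/ple_MP; rewrite dE !pfst_opair !psnd_opair -dE; split.
by exists (opair u z); split=> //; apply: MPtr uzd dr0.
Qed.

(** [trace] is put on top of the chain of [p]: this chain is finite and in [N], so its models are in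
    [N], and as countable subsets of [H θ] they are in [H θ]. *)
Lemma MP_generic_below p : p ∈ conditions (MP θ P) -> p ∈ N ->
  exists q, [/\ q ∈ conditions (MP θ P), ple (MP θ P) q p & generic N (MP θ P) q].
Proof.
move=> /[dup] pP /in_conditions_MP [c [w [pE [[cchain cel] wP cgen]]]] pN.
have HθN := H_in_elementary wP.
have [cN wN] : c ∈ N /\ w ∈ N by apply: elementary_opair_proj Htr NH _; rewrite -pE.
have tce := trace_countable_elementary HθN.
have XHθ := conditions_in_H.
have Pt : P ∈ trace by apply/in_trace; split=> //; exact: poset_in_elementary.
have wt : w ∈ trace by apply/in_trace; split=> //; exact: H_transitive XHθ wP.
have [w' [w'P w'w w'gen]] := Pgen tce Pt wP wt.
have ct x : x ∈ c -> x ∈ trace.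
  move=> xc; apply/in_trace; split; first exact: finite_chain_in_elementary cN _ xc.
  exact: countable_elementary_in_H (cel _ xc).
have [s sE ssort] := cchain.
have sP x : x \in s <-> x ∈ c by rewrite -[x ∈ c]/(elts c x) sE.
have q_cond : MP_condition θ P (zadjoin c trace) w'.
  split=> //; last first.
    by move=> m /in_zadjoin[/cgen mg|->//]; exact: generic_le mg w'w.
  split; last by move=> m /in_zadjoin[/cel|->].
  exists (rcons s trace); last first.
    by apply: sorted_rcons_all => // x /sP /ct ?; apply/asboolP.
  apply/seteqP; split=> x /=; rewrite mem_rcons inE.
    by move=> /in_zadjoin[/sP ->|->]; rewrite ?orbT ?eqxx.
  by move=> /predU1P[->|/sP xc]; apply/in_zadjoin; [right|left].
have qP : opair (zadjoin c trace) w' ∈ conditions (MP θ P) by apply/opair_MP_condition.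
exists (opair (zadjoin c trace) w'); split=> //.
  rewrite pE in pP *; apply/ple_MP; rewrite !pfst_opair !psnd_opair; split=> //.
  by move=> x xc; apply/in_zadjoin; left.
by apply: MP_generic => //; apply/in_zadjoin; right.
Qed.

End Properness.

(** * Choosing the thresholds *)

Theorem theorem2p5 (P : zfset) (hP : proper P) :
  for_large_regular (fun θ => P ∈ H θ -> proper (MP θ P)).
Proof.
have [Ppo [θ1 θ1o Pgen]] := hP.
(* [θ0] lies above the threshold for [P] and above ω, which makes every regular [θ] above it
   uncountable. *)
have [θ0 θ0o [θ10 ω0]] := ordinal_upper_bound θ1o ordinal_zomega.
exists θ0 => // θ θreg θ0θ PH; split; first exact: MP_poset.
have [[[θT _] _] _ _] := θreg.
have θr : uncountable_regular θ.
  by apply: uncountable_regular_gt_omega => //; apply: θT θ0θ ω0.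
(* For [MP θ P] the threshold is [θ] itself, since the argument compares [H θ] with [H l] for
   [θ ∈ l]. *)
exists θ; first by case: θreg => -[].
move=> l lreg θl _ N Nel MPN p pP pN.
have lr := uncountable_regular_above θr lreg θl.
apply: (MP_generic_below θr lr θl Ppo PH Nel MPN) => //.
by apply: Pgen => //; apply: θT θ0θ θ10.
Qed.
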